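(* For all $l=1,2,\dots,L$ the approximate solution $\tilde y_l^*$ and the optimal error $\tilde e_l^*$ of the discrete multi-grade deep learning model satisfy $$\|\mathbf{M}_\kappa\|_2^{-1}\big(\|\tilde e_l^*\|_N-R_{p_\kappa}\big)\le\|y-\tilde y_l^*\|_N\le\|\mathbf{M}_\kappa^{-1}\|_2\big(\|\tilde e_l^*\|_N+R_{p_\kappa}\big),$$ where $R_{p_\kappa}:=\|(\mathcal{K}_{p_\kappa}-\mathcal{K})y\|_N$ is the quadrature error.
   Context: Let $I:=[-1,1]$, and let $C(I)$ be the space of continuous complex-valued functions on $I$. Let $\kappa\ge 1$, let $K$ be a continuous complex-valued function on $I^2$, and $f\in C(I)$. Define $(\mathcal{K}h)(s):=\int_I K(s,t)e^{i\kappa|s-t|}h(t)\,dt$ for $h\in C(I)$, $s\in I$; $\mathcal{I}$ is the identity on $C(I)$. The function $y\in C(I)$ is the solution of $(\mathcal{I}-\mathcal{K})y=f$. Let $x_1,\dots,x_N\in I$ be distinct (collocation) points and $\|g\|_N:=\sqrt{\frac1N\sum_{j=1}^N|g(x_j)|^2}$ for $g\in C(I)$ (a semi-norm). Let $\mathcal{K}_{p_\kappa}:C(I)\to C(I)$ be a linear operator approximating $\mathcal{K}$ obtained from a numerical integration scheme with quadrature nodes $s_0,\dots,s_{p_\kappa}\in I$ (so $\mathcal{K}_{p_\kappa}h$ depends on $h$ only through the values $h(s_j)$). Assume that the quadrature nodes coincide with the collocation points ($p_\kappa=N-1$), and that $\mathbf{M}_\kappa\in\mathbb{C}^{N\times N}$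 is an invertible matrix such that $[((\mathcal{I}-\mathcal{K}_{p_\kappa})h)(x_j)]_{j=1}^N=\mathbf{M}_\kappa[h(x_j)]_{j=1}^N$ for all $h\in C(I)$. For matrices, $\|\cdot\|_2$ is the spectral norm. For a function $u=[u_1,u_2]^T$ with $u_1,u_2$ real-valued on $I$, $\mathcal{T}u:=u_1+iu_2$. Let $\sigma:\mathbb{R}\to\mathbb{R}$ be a continuous activation function, applied componentwise. For weight matrices $\mathbf{W}_j$ and bias vectors $\mathbf{b}_j$ of compatible sizes and an input vector $x$, let $\mathcal{F}_k(\{\mathbf{W}_j,\mathbf{b}_j\}_{j=1}^k;x)$ be the result of applying to $x$ successively the maps $v\mapsto\sigma(\mathbf{W}_jv+\mathbf{b}_j)$, $j=1,\dots,k$ (the identity if $k=0$), and let $\mathcal{N}_n(\{\mathbf{W}_j,\mathbf{b}_j\}_{j=1}^n;x):=\mathbf{W}_n\mathcal{F}_{n-1}(\{\mathbf{W}_j,\mathbf{b}_j\}_{j=1}^{n-1};x)+\mathbf{b}_n$. Discrete multi-grade deep learning model: let $L$ and $n_1,\dots,n_L$ be positive integers, and let $m_{l,j}$ ($1\le l\le L$, $0\le j\le n_l$) be positive integers with $m_{1,0}=1$, $m_{l,n_l}=2$, $m_{l+1,0}=m_{l,n_l-1}$. Put $\tilde{\mathbf{g}}_0(s):=s$ and $\tilde e_0^*:=f$. Recursively for $l=1,\dots,L$: for $\theta=\{\mathbf{W}_j,\mathbf{b}_j\}_{j=1}^{n_l}$ with $\mathbf{W}_j\in\mathbb{R}^{m_{l,j}\times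 m_{l,j-1}}$, $\mathbf{b}_j\in\mathbb{R}^{m_{l,j}}$, set $$\tilde e_l(\theta;s):=\tilde e_{l-1}^*(s)-\big[(\mathcal{I}-\mathcal{K}_{p_\kappa})\mathcal{T}\mathcal{N}_{n_l}(\theta;\tilde{\mathbf{g}}_{l-1}(\cdot))\big](s),\quad s\in I;$$ let $\{\tilde{\mathbf{W}}_{l,j}^*,\tilde{\mathbf{b}}_{l,j}^*\}_{j=1}^{n_l}$ be a minimizer of $\|\tilde e_l(\theta;\cdot)\|_N^2$ over all such $\theta$ (existence of minimizers is assumed throughout); set $\tilde{\mathbf{g}}_l(s):=\mathcal{F}_{n_l-1}(\{\tilde{\mathbf{W}}_{l,j}^*,\tilde{\mathbf{b}}_{l,j}^*\}_{j=1}^{n_l-1};\tilde{\mathbf{g}}_{l-1}(s))$, $\tilde{\mathbf{f}}_l(s):=\tilde{\mathbf{W}}_{l,n_l}^*\tilde{\mathbf{g}}_l(s)+\tilde{\mathbf{b}}_{l,n_l}^*$, $\tilde y_l^*:=\sum_{j=1}^l\mathcal{T}\tilde{\mathbf{f}}_j$, and $\tilde e_l^*(s):=\tilde e_l(\{\tilde{\mathbf{W}}_{l,j}^*,\tilde{\mathbf{b}}_{l,j}^*\}_{j=1}^{n_l};s)$. *)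

(* Defs.v *)
From HB Require Import structures.
From mathcomp Require Import all_boot all_order all_algebra.
From mathcomp Require Import all_classical all_reals all_analysis.
From mathcomp.real_closed Require Export complex.

Set Implicit Arguments.
Unset Strict Implicit.
Unset Printing Implicit Defensive.

Import Order.TTheory GRing.Theory Num.Theory.
Import numFieldNormedType.Exports.

Local Open Scope classical_set_scope.
Local Open Scope ring_scope.
Local Open Scope complex_scope.

Section ComplexFunctions.
Variable R : realType.
Implicit Types (h f y : R -> R[i]) (Kp : (R -> R[i]) -> R -> R[i]).

Definition II : set R := `[-1, 1].

(* C(I) is represented by the functions R -> R[i] whose restriction to I is
   continuous; their values off I carry no meaning.  The coercion to
   numClosedFieldType gives R[i] the topology of its modulus. *)
Definition in_CI h : Prop :=
  {within II, continuous (h : R -> (R[i] : numClosedFieldType))}.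

Definition continuous_on_II2 (K : R -> R -> R[i]) : Prop :=
  {within II `*` II,
    continuous (fun z : R * R => K z.1 z.2 : (R[i] : numClosedFieldType))}.

Definition cabs (z : R[i]) : R := complex.Re `|z|.

Definition integralI h : R[i] :=
  Rintegral lebesgue_measure II (fun t => complex.Re (h t)) +i*
  Rintegral lebesgue_measure II (fun t => complex.Im (h t)).

Definition expi (x : R) : R[i] := cos x +i* sin x.

Definition oscK (kappa : R) (K : R -> R -> R[i]) h (s : R) : R[i] :=
  integralI (fun t => K s t * expi (kappa * `|s - t|) * h t).

Definition solves (kappa : R) (K : R -> R -> R[i]) f y : Prop :=
  in_CI y /\ forall s, II s -> y s - oscK kappa K y s = f s.

Definition is_the_solution (kappa : R) (K : R -> R -> R[i]) f y : Prop :=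
  solves kappa K f y /\
  forall z, solves kappa K f z -> forall s, II s -> z s = y s.

Definition maps_CI Kp : Prop := forall h, in_CI h -> in_CI (Kp h).

Definition linear_CI Kp : Prop :=
  forall (a : R[i]) h1 h2, in_CI h1 -> in_CI h2 -> forall s, II s ->
    Kp (fun t => a * h1 t + h2 t) s = a * Kp h1 s + Kp h2 s.

Definition depends_on_nodes p (node : 'I_p.+1 -> R) Kp : Prop :=
  forall h1 h2, in_CI h1 -> in_CI h2 ->
    (forall j, h1 (node j) = h2 (node j)) ->
    forall s, II s -> Kp h1 s = Kp h2 s.

Definition seminormN N (x : 'I_N -> R) h : R :=
  Num.sqrt (N%:R^-1 * \sum_(j < N) cabs (h (x j)) ^+ 2).

Definition samples N (x : 'I_N -> R) h : 'cV[R[i]]_N := \col_j h (x j).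

Definition norm2 n (v : 'cV[R[i]]_n) : R :=
  Num.sqrt (\sum_(j < n) cabs (v j 0) ^+ 2).

(* Operator norm induced by the Euclidean norms. *)
Definition spectral_norm m n (A : 'M[R[i]]_(m, n)) : R :=
  sup [set norm2 (A *m v) | v in [set v : 'cV[R[i]]_n | norm2 v = 1]].

End ComplexFunctions.

(* Identification of column vectors whose (propositionally equal) sizes are not
   convertible; the entries are unchanged when d = d'. *)
Definition recast (R : realType) d d' (v : 'cV[R]_d) : 'cV[R]_d' :=
  conform_mx (0 : 'cV[R]_d') v.
Arguments recast {R d d'} v.

(* Only the layers 1 <= j <= n are used by a network of depth n; the other
   entries are never read. *)
Record params (R : realType) (w : nat -> nat) := Params {
  weight : forall j, 'M[R]_(w j, w j.-1);
  bias : forall j, 'cV[R]_(w j)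
}.

Section Networks.
Variables (R : realType) (sigma : R -> R) (w : nat -> nat).

Fixpoint hidden (th : params R w) (k : nat) (v : 'cV[R]_(w 0)) : 'cV[R]_(w k) :=
  if k is k'.+1 then
    map_mx sigma (weight th k'.+1 *m hidden th k' v + bias th k'.+1)
  else v.

Definition network (th : params R w) (n : nat) (v : 'cV[R]_(w 0)) : 'cV[R]_(w n) :=
  weight th n *m hidden th n.-1 v + bias th n.

End Networks.

Definition toC (R : realType) (u : 'cV[R]_2) : R[i] := u 0 0 +i* u 1 0.

Section MultiGrade.
Variables (R : realType) (sigma : R -> R) (Kp : (R -> R[i]) -> R -> R[i]).
Variables (f : R -> R[i]) (n : nat -> nat) (m : nat -> nat -> nat).
Implicit Types (TH : forall l, params R (m l)).

Definition feature_dim (l : nat) : nat := if l is l'.+1 then m l (n l).-1 else 1.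

Fixpoint feature TH (l : nat) (s : R) : 'cV[R]_(feature_dim l) :=
  if l is l'.+1 then
    hidden sigma (TH l'.+1) (n l'.+1).-1 (recast (feature TH l' s))
  else const_mx s.

(* Meaningful for l >= 1, as are error and grade_out. *)
Definition grade_net TH (l : nat) (th : params R (m l)) (s : R) : R[i] :=
  toC (recast (network sigma th (n l) (recast (feature TH l.-1 s)))).

Definition residual (e : R -> R[i]) (h : R -> R[i]) (s : R) : R[i] :=
  e s - (h s - Kp h s).

Fixpoint opt_error TH (l : nat) : R -> R[i] :=
  if l is l'.+1 then residual (opt_error TH l') (grade_net TH (TH l'.+1))
  else f.

Definition error TH (l : nat) (th : params R (m l)) : R -> R[i] :=
  residual (opt_error TH l.-1) (grade_net TH th).

Definition grade_out TH (l : nat) (s : R) : 'cV[R]_(m l (n l)) :=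
  weight (TH l) (n l) *m recast (feature TH l s) + bias (TH l) (n l).

Definition approx_sol TH (l : nat) (s : R) : R[i] :=
  \sum_(1 <= j < l.+1) toC (recast (grade_out TH j s)).

(* TH l is a minimizer of the squared discrete residual of grade l, given the
   previously trained grades (error TH th reads TH only below l). *)
Definition minimizers N (x : 'I_N -> R) (L : nat) TH : Prop :=
  forall l, (1 <= l <= L)%N -> forall th : params R (m l),
    seminormN x (error TH (TH l)) ^+ 2 <= seminormN x (error TH th) ^+ 2.

End MultiGrade.

Definition architecture (L : nat) (n : nat -> nat) (m : nat -> nat -> nat) : Prop :=
  [/\ (0 < L)%N,
      forall l, (1 <= l <= L)%N ->
        [/\ (0 < n l)%N, forall j, (j <= n l)%N -> (0 < m l j)%N & m l (n l) = 2%N],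
      m 1%N 0%N = 1%N &
      forall l, (1 <= l < L)%N -> m l.+1 0%N = m l (n l).-1].

(* Main.v *)
Require Import Defs.
From mathcomp Require Import all_boot all_order all_algebra.
From mathcomp Require Import all_classical all_reals all_analysis.

Import Order.TTheory GRing.Theory Num.Theory.
Import numFieldNormedType.Exports.

Local Open Scope classical_set_scope.
Local Open Scope ring_scope.

(** The residuals telescope.  Each grade subtracts (I - Kp) applied to its own
    network, and at the collocation points I - Kp acts as the matrix M, so the
    vector e of samples of the grade-l residual is F - M Y_l, where F and Y_l
    are the samples of f and of the approximate solution
    ([samples_opt_error]).  The relation between I - Kp and M holds for
    functions in C(I); it applies here because a network with a continuous
    activation function is continuous ([grade_net_in_CI]).

    The exact solution satisfies f = (I - Kp) y + (Kp y - K y) on I, so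
    F = M Y + r, with Y the samples of y and r those of Kp y - K y.  Hence
    M (Y - Y_l) = e - r.  Up to the common factor N^(-1/2) the discrete
    semi-norm is the Euclidean norm of the sample vector ([seminormNE]), and
    the two bounds are the triangle inequality together with
    |A v| <= ||A|| |v| ([norm2_mulmx_le]), applied to A = M for the lower bound
    and to A = M^-1 for the upper one. *)

Set Implicit Arguments.
Unset Strict Implicit.

(** * The Euclidean norm on complex vectors *)

Lemma cabsE (R : realType) (z : R[i]) : (cabs z)%:C%C = `|z|.
Proof. by rewrite /cabs RRe_real // normr_real. Qed.

Lemma norm2_ge0 (R : realType) n (v : 'cV[R[i]]_n) : 0 <= norm2 v.
Proof. exact: sqrtr_ge0. Qed.

Lemma sqrtC_real (R : realType) (a : R) :
  0 <= a -> sqrtC (a%:C)%C = (Num.sqrt a)%:C%C.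
Proof.
move=> a0; rewrite -[in LHS](sqr_sqrtr a0) rmorphXn /= sqrCK //.
by rewrite lecR sqrtr_ge0.
Qed.

(** This identifies [norm2] with the norm of the Hermitian inner product, so that
    the triangle inequality and homogeneity come from the general theory. *)
Lemma norm2_dotmx (R : realType) n (v : 'cV[R[i]]_n) :
  (norm2 v)%:C%C = sqrtC (dotmx v^T v^T).
Proof.
rewrite /norm2 -sqrtC_real; last by apply: sumr_ge0 => j _; exact: sqr_ge0.
congr sqrtC; rewrite dotmxE mxE rmorph_sum; apply: eq_bigr => j _ /=.
by rewrite rmorphXn /= cabsE !mxE normCK.
Qed.

Lemma norm2D (R : realType) n (u v : 'cV[R[i]]_n) :
  norm2 (u + v) <= norm2 u + norm2 v.
Proof.
rewrite -lecR rmorphD /= !norm2_dotmx linearD.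
exact: triangle_lerif.
Qed.

Lemma norm2Z (R : realType) n (a : R[i]) (v : 'cV[R[i]]_n) :
  norm2 (a *: v) = cabs a * norm2 v.
Proof.
apply: complexI; rewrite rmorphM /= !norm2_dotmx cabsE linearZ /= dnormZ.
rewrite sqrtCM ?qualifE/= ?exprn_ge0 ?dnorm_ge0 //.
by rewrite sqrCK.
Qed.

Lemma norm20 (R : realType) n : norm2 (0 : 'cV[R[i]]_n) = 0.
Proof. by rewrite -(scale0r 0) norm2Z /cabs normr0 mul0r. Qed.

Lemma norm2N (R : realType) n (v : 'cV[R[i]]_n) : norm2 (- v) = norm2 v.
Proof. by rewrite -scaleN1r norm2Z /cabs normrN1 mul1r. Qed.

Lemma norm2_eq0 (R : realType) n (v : 'cV[R[i]]_n) : norm2 v = 0 -> v = 0.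
Proof.
move=> v0; apply: trmx_inj; apply/eqP.
rewrite linear0 -(dnorm_eq0 (@dotmx _ n)) -sqrtC_eq0 -norm2_dotmx.
by rewrite v0.
Qed.

Lemma norm2_sum (R : realType) n (I : Type) (r : seq I)
  (F : I -> 'cV[R[i]]_n) :
  norm2 (\sum_(i <- r) F i) <= \sum_(i <- r) norm2 (F i).
Proof.
elim/big_ind2: _ => [|u a v b ua vb|//]; first by rewrite norm20.
by apply: le_trans (norm2D _ _) _; exact: lerD.
Qed.

Lemma cabs_le_norm2 (R : realType) n (v : 'cV[R[i]]_n) j :
  cabs (v j 0) <= norm2 v.
Proof.
have c0 (z : R[i]) : 0 <= cabs z by rewrite -lecR cabsE normr_ge0.
rewrite -[leLHS]ger0_norm // -sqrtr_sqr ler_wsqrtr // (bigD1 j) //= lerDl.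
by apply: sumr_ge0 => k _; exact: sqr_ge0.
Qed.

(** * The spectral norm *)

(** A supremum of an unbounded set would be 0 by convention, so an a priori
    bound is needed: A v is a combination of the columns of A whose
    coefficients have modulus at most |v|. *)
Lemma spectral_norm_has_ubound (R : realType) m n (A : 'M[R[i]]_(m, n)) :
  has_ubound [set norm2 (A *m v) | v in [set v : 'cV[R[i]]_n | norm2 v = 1]].
Proof.
exists (\sum_j norm2 (col j A)) => _ [v /= v1 <-].
have -> : A *m v = \sum_j v j 0 *: col j A.
  apply/colP => i; rewrite mxE summxE; apply: eq_bigr => j _.
  by rewrite !mxE mulrC.
apply: le_trans (norm2_sum _ _) _; apply: ler_sum => j _.
rewrite norm2Z ler_piMl ?norm2_ge0 //.
by rewrite -v1 cabs_le_norm2.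
Qed.

(** Normalizing v reduces the bound to the unit sphere; the zero vector, which
    cannot be normalized, is treated apart. *)
Lemma norm2_mulmx_le (R : realType) m n (A : 'M[R[i]]_(m, n)) v :
  norm2 (A *m v) <= spectral_norm A * norm2 v.
Proof.
have [v0|v0] := eqVneq (norm2 v) 0.
  by rewrite v0 (norm2_eq0 v0) mulmx0 norm20 mulr0.
have v_gt0 : 0 < norm2 v by rewrite lt_def v0 norm2_ge0.
pose a : R[i] := ((norm2 v)^-1)%:C%C.
have aE : cabs a = (norm2 v)^-1.
  by apply: complexI; rewrite cabsE ger0_norm // lecR invr_ge0 norm2_ge0.
rewrite -ler_pdivrMr // mulrC -aE -norm2Z scalemxAr.
apply: ub_le_sup; first exact: spectral_norm_has_ubound.
by exists (a *: v) => //=; rewrite norm2Z aE mulVf.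
Qed.

(** When n = 0 the unit sphere is empty and the supremum is 0. *)
Lemma spectral_norm_ge0 (R : realType) m n (A : 'M[R[i]]_(m, n)) :
  0 <= spectral_norm A.
Proof.
rewrite /spectral_norm; set S := [set _ | _ in _].
have [->|/set0P[_ [v v1 _]]] := eqVneq S set0; first by rewrite sup0.
apply: le_trans (norm2_ge0 (A *m v)) _.
by apply: ub_le_sup; [exact: spectral_norm_has_ubound|exists v].
Qed.

Lemma seminormNE (R : realType) N (x : 'I_N -> R) h :
  seminormN x h = Num.sqrt N%:R^-1 * norm2 (samples x h).
Proof.
rewrite /seminormN sqrtrM ?invr_ge0 ?ler0n //; congr (_ * Num.sqrt _).
by apply: eq_bigr => j _; rewrite mxE.
Qed.

(** * Continuity of the networks *)

Lemma continuous_toC (R : realType) (u : R -> 'cV[R]_2) :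
  (forall i, continuous (fun s => u s i 0)) ->
  continuous ((fun s => toC (u s)) : R -> (R[i] : numClosedFieldType)).
Proof.
move=> cu s; apply/cvgrPdist_lt => e e0.
have eE : e = (complex.Re e)%:C%C by rewrite RRe_real // ger0_real // ltW.
(* Each of the two components may use half of the tolerance. *)
have e'0 : 0 < complex.Re e / 2 by rewrite divr_gt0 // -ltcR -eE.
have c0 := cu 0 s; have c1 := cu 1 s.
move/cvgrPdist_lt/(_ _ e'0): c0; move/cvgrPdist_lt/(_ _ e'0): c1.
apply: filterS2 => t /= h1 h0.
rewrite eE (complexE (toC (u s) - toC (u t))) /=.
apply: le_lt_trans (ler_normD _ _) _.
rewrite normrM [X in _ + X * _](_ : _ = 1); last first.
  by rewrite normc_def /= expr0n expr1n add0r sqrtr1.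
rewrite mul1r !normc_def /= !expr0n /= !addr0 !sqrtr_sqr -rmorphD ltcR.
by rewrite (splitr (complex.Re e)) ltrD.
Qed.

(** Working entry by entry avoids putting a topology on matrices. *)
Definition entrywise_continuous (R : realType) d (u : R -> 'cV[R]_d) : Prop :=
  forall i, continuous (fun s => u s i 0).

(** Between unequal dimensions [recast] is the constant 0, which is
    continuous as well; between equal ones it is the identity. *)
Lemma continuous_recast (R : realType) d d' (u : R -> 'cV[R]_d) :
  entrywise_continuous u ->
  entrywise_continuous (fun s => recast (u s) : 'cV_d').
Proof.
move=> cu i; have [dd'|dd'] := eqVneq d d'.
  by subst d'; under eq_fun do rewrite /recast conform_mx_id; exact: cu.
have -> : (fun s => (recast (u s) : 'cV_d') i 0) = (fun=> 0).
  apply/funext => s; rewrite /recast nonconform_mx ?mxE //.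
  by rewrite dd'.
by move=> s; exact: cvg_cst.
Qed.

Lemma continuous_affine (R : realType) d d' (A : 'M[R]_(d', d)) b u :
  entrywise_continuous u ->
  entrywise_continuous (fun s => A *m u s + b).
Proof.
move=> cu i; under eq_fun do rewrite !mxE.
move=> s; apply: cvgD; last exact: cvg_cst.
apply: cvg_big => [|j _]; first exact: add_continuous.
by apply: cvgM; [exact: cvg_cst|exact: cu].
Qed.

Lemma continuous_hidden (R : realType) sigma w (th : params R w) k u :
  continuous sigma -> entrywise_continuous u ->
  entrywise_continuous (fun s => hidden sigma th k (u s)).
Proof.
move=> csigma cu; elim: k => [//|k IH] i.
under eq_fun do rewrite /= mxE.
move=> s; apply: continuous_comp; last exact: csigma.
exact: (continuous_affine IH).
Qed.

Lemma continuous_feature (R : realType) sigma n m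
  (TH : forall l, params R (m l)) l :
  continuous sigma ->
  entrywise_continuous (feature sigma n TH l).
Proof.
move=> csigma; elim: l => [|l IH].
  by move=> i; under eq_fun do rewrite mxE; move=> s; exact: cvg_id.
apply: (continuous_hidden (th := TH l.+1) (k := (n l.+1).-1) csigma).
exact: continuous_recast.
Qed.

Lemma grade_net_in_CI (R : realType) sigma n m
  (TH : forall l, params R (m l)) l (th : params R (m l)) :
  continuous sigma -> in_CI (grade_net sigma n TH th).
Proof.
move=> csigma; apply: continuous_subspaceT; apply: continuous_toC.
apply: continuous_recast; apply: continuous_affine.
apply: continuous_hidden => //; apply: continuous_recast.
exact: continuous_feature.
Qed.

(** * Telescoping of the residuals *)

(** The widths on both sides are convertible here, because [feature_dim] at a
    successor unfolds to the width of the last hidden layer. *)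
Lemma grade_outE (R : realType) sigma n m (TH : forall l, params R (m l)) l s :
  toC (recast (grade_out sigma n TH l.+1 s))
  = grade_net sigma n TH (TH l.+1) s.
Proof.
by rewrite /grade_net /grade_out /network /= /recast conform_mx_id.
Qed.

Lemma approx_solS (R : realType) sigma n m (TH : forall l, params R (m l)) l s :
  approx_sol sigma n TH l.+1 s
  = approx_sol sigma n TH l s + grade_net sigma n TH (TH l.+1) s.
Proof. by rewrite /approx_sol big_nat_recr //= grade_outE. Qed.

(** By induction on the grade: grade l + 1 subtracts M times the samples of its
    own network, and that network is the increment of the approximate
    solution. *)
Lemma samples_opt_error (R : realType) N (x : 'I_N -> R)
  (Kp : (R -> R[i]) -> R -> R[i]) (M : 'M[R[i]]_N) (f : R -> R[i])
  sigma n m (TH : forall l, params R (m l)) l :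
  (forall h, in_CI h ->
     samples x (fun s => h s - Kp h s) = M *m samples x h) ->
  continuous sigma ->
  samples x (opt_error sigma Kp f n TH l)
  = samples x f - M *m samples x (approx_sol sigma n TH l).
Proof.
move=> hM csigma; elim: l => [|l IH].
  rewrite [X in _ *m X](_ : _ = 0) ?mulmx0 ?subr0 //.
  by apply/colP => j; rewrite !mxE /approx_sol big_geq.
set g := grade_net sigma n TH (TH l.+1).
have -> : samples x (opt_error sigma Kp f n TH l.+1) =
    samples x (opt_error sigma Kp f n TH l) -
    samples x (fun s => g s - Kp g s).
  by apply/colP => j; rewrite !mxE.
rewrite hM; last exact: grade_net_in_CI.
rewrite IH -addrA -opprD -mulmxDr; congr (_ - _ *m _).
by apply/colP => j; rewrite !mxE approx_solS.
Qed.

(** * The two-sided error estimate *)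

Unset Implicit Arguments.
Set Strict Implicit.

Theorem theorem4 (R : realType)
  (kappa : R) (hkappa : 1 <= kappa)
  (K : R -> R -> R[i]) (hK : continuous_on_II2 K)
  (f : R -> R[i]) (hf : in_CI f)
  (y : R -> R[i]) (hy : is_the_solution kappa K f y)
  (N p : nat) (hNp : N = p.+1)
  (x : 'I_N -> R) (hx : forall j, II (x j)) (hxinj : injective x)
  (node : 'I_p.+1 -> R) (hnode : forall j, II (node j))
  (hcoincide : range node = range x)
  (Kp : (R -> R[i]) -> R -> R[i])
  (hKpC : maps_CI Kp) (hKplin : linear_CI Kp) (hKpnode : depends_on_nodes node Kp)
  (M : 'M[R[i]]_N) (hMunit : M \in unitmx)
  (hM : forall h, in_CI h ->
     samples x (fun s => h s - Kp h s) = M *m samples x h)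
  (sigma : R -> R) (hsigma : continuous sigma)
  (L : nat) (n : nat -> nat) (m : nat -> nat -> nat)
  (harch : architecture L n m)
  (TH : forall l, params R (m l))
  (hTH : minimizers sigma Kp f n x L TH)
  (l : nat) (hl : (1 <= l <= L)%N) :
  let Rp := seminormN x (fun s => Kp y s - oscK kappa K y s) in
  let E := seminormN x (opt_error sigma Kp f n TH l) in
  let D := seminormN x (fun s => y s - approx_sol sigma n TH l s) in
  (spectral_norm M)^-1 * (E - Rp) <= D /\
  D <= spectral_norm (invmx M) * (E + Rp).
Proof.
move=> Rp E D.
set v := samples x (fun s => y s - approx_sol sigma n TH l s).
set e := samples x (opt_error sigma Kp f n TH l).
set r := samples x (fun s => Kp y s - oscK kappa K y s).
have Mv : M *m v = e - r.
  have [[yC yE] _] := hy.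
  have -> : v = samples x y - samples x (approx_sol sigma n TH l).
    by apply/colP => j; rewrite !mxE.
  rewrite mulmxBr -(hM y yC) /e (samples_opt_error f n TH l hM hsigma).
  rewrite [RHS]addrAC; congr (_ - _).
  apply/colP => j; rewrite !mxE -yE //.
  by rewrite opprB addrA subrK.
have c0 : 0 <= Num.sqrt (N%:R^-1 : R) by exact: sqrtr_ge0.
rewrite /Rp /E /D !seminormNE -/v -/e -/r -mulrBr -mulrDr.
rewrite !(mulrCA _ (Num.sqrt _)); split; apply: ler_wpM2l => //.
- have Sge0 := spectral_norm_ge0 M.
  (* The inverse of 0 is 0, which makes the bound trivial in this case. *)
  have [S0|S0] := eqVneq (spectral_norm M) 0.
    by rewrite S0 invr0 mul0r norm2_ge0.
  have Sgt0 : 0 < spectral_norm M by rewrite lt_def S0.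
  rewrite ler_pdivrMl //; apply: le_trans (norm2_mulmx_le _ _).
  rewrite lerBlDr Mv; apply: le_trans (norm2D _ _).
  by rewrite subrK.
- rewrite -(mulKmx hMunit v) Mv.
  apply: le_trans (norm2_mulmx_le _ _) _.
  apply: ler_wpM2l; first exact: spectral_norm_ge0.
  by apply: le_trans (norm2D _ _) _; rewrite norm2N.
Qed.
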